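(* Let $\Gamma$ be an infinite countable group and let $(X,\mu)$ be a standard non-atomic probability space. For each finite $F\subseteq\Gamma$ and $r\in\mathbb R\cup\{\infty\}$ the set $A_{F,r}(\Gamma,X,\mu)\cap\mathrm{FR}(\Gamma,X,\mu)$ is contained in the interior of $A_{F,r}(\Gamma,X,\mu)$ in $A(\Gamma,X,\mu)$. In particular, $A_{F,r}(\Gamma,X,\mu)\cap\mathrm{FR}(\Gamma,X,\mu)$ is open in $\mathrm{FR}(\Gamma,X,\mu)$.
   Context: $\mathrm{Aut}(X,\mu)$ is the Polish group of measure preserving automorphisms of $(X,\mu)$ (mod null sets) with the weak topology, and $A(\Gamma,X,\mu)$ is the Polish space of measure preserving actions of $\Gamma$ on $(X,\mu)$, viewed as a closed subspace of $\mathrm{Aut}(X,\mu)^\Gamma$. $\mathrm{FR}(\Gamma,X,\mu)\subseteq A(\Gamma,X,\mu)$ is the subspace of free actions, i.e. those $\boldsymbol a$ with $\mu(\{x:\gamma^ax=x\})=0$ for all $\gamma\ne e$. For $\boldsymbol a\in A(\Gamma,X,\mu)$ let $E_a$ be its orbit equivalence relation, and for a subgroup $H\le\Gamma$ let $E_{a\restriction H}$ be the orbit equivalence relation of the restriction of $\boldsymbol a$ to $H$. $\langle F\rangle$ is the subgroup generated by $F$. Cost. An L-graphing on $(X,\mu)$ is a countable family $\Phi=\{\varphi_i:A_i\to B_i\}$ of $\mu$-preserving Borel bijections between Borel subsets of $X$; its cost is $C_\mu(\Phi)=\sum_i\mu(A_i)$. It is an L-graphing of a $\mu$-preserving countable Borel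 equivalence relation $E$ if the equivalence relation generated by $\Phi$ agrees with $E$ on a conull set. $C_\mu(E)=\inf\{C_\mu(\Phi):\Phi\text{ an L-graphing of }E\}\in[0,\infty]$. $A_{F,r}(\Gamma,X,\mu)$ is the set of all $\boldsymbol a\in A(\Gamma,X,\mu)$ for which there exists a Borel equivalence relation $E$ with $E_{a\restriction\langle F\rangle}\subseteq E\subseteq E_a$ and $C_\mu(E)<r$. *)

(* Defs.v *)
From HB Require Import structures.
From Stdlib Require Import Relation_Definitions Relation_Operators.
From mathcomp Require Import all_boot all_order all_algebra generic_quotient.
From mathcomp Require Import all_classical all_reals all_analysis.

Set Implicit Arguments.
Unset Strict Implicit.
Unset Printing Implicit Defensive.

Import numFieldNormedType.Exports.

Local Open Scope classical_set_scope.
Local Open Scope ring_scope.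
Local Open Scope quotient_scope.

(* Polish = separable and completely metrizable; a Hausdorff
   [completePseudoMetricType] is a complete metric space. *)
Definition standard_borel (R : realType) d (X : measurableType d) : Prop :=
  exists P : completePseudoMetricType R,
    [/\ hausdorff_space P, @second_countable P &
    exists f : X -> P, bijective f /\
      forall B : set P, measurable (f @^-1` B) <-> <<s open >> B].

Definition nonatomic (R : realType) d (X : measurableType d)
    (mu : {measure set X -> \bar R}) : Prop :=
  forall A, measurable A -> (0 < mu A)%E ->
    exists B, [/\ measurable B, B `<=` A & (0 < mu B < mu A)%E].

Section automorphisms.
Context (R : realType) d (X : measurableType d) (mu : probability X R).

Record mpauto := Mpauto {
  mpauto_fun :> X -> X;
  mpauto_bij : bijective mpauto_fun;
  mpauto_measurable : measurable_fun [set: X] mpauto_fun;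
  mpauto_image : forall A, measurable A -> measurable (mpauto_fun @` A);
  mpauto_preserving : forall A, measurable A -> mu (mpauto_fun @^-1` A) = mu A
}.

HB.instance Definition _ := gen_eqMixin mpauto.
HB.instance Definition _ := gen_choiceMixin mpauto.

Definition mpauto_eq (f g : mpauto) : bool :=
  `[< {ae mu, forall x, f x = g x} >].

Lemma mpauto_eq_refl : reflexive mpauto_eq.
Proof. by move=> f; apply/asboolP; apply: aeW. Qed.

Lemma mpauto_eq_sym : symmetric mpauto_eq.
Proof.
have H f g : mpauto_eq f g -> mpauto_eq g f.
  by move=> /asboolP fg; apply/asboolP; apply: filterS fg.
by move=> f g; apply/idP/idP; exact: H.
Qed.

Lemma mpauto_eq_trans : transitive mpauto_eq.
Proof.
move=> g f h /asboolP fg /asboolP gh; apply/asboolP.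
by apply: filterS2 fg gh => x -> ->.
Qed.

Canonical mpauto_equiv :=
  EquivRel mpauto_eq mpauto_eq_refl mpauto_eq_sym mpauto_eq_trans.

(* Aut(X, mu) *)
Definition aut := {eq_quot mpauto_equiv}.

HB.instance Definition _ := Choice.on aut.

(* A representative: only its properties modulo null sets are meaningful. *)
Definition aut_fun (T : aut) : X -> X := repr T.

Coercion aut_fun : aut >-> Funclass.

(* The weak topology is generated by the maps T |-> T(A) into the measure
   algebra with metric mu (A `+` B): subbasic open sets are the preimages of
   the open balls, here indexed by (A, center, radius). *)
HB.instance Definition _ := @isSubBaseTopological.Build aut
  ((set X * set X * R)%type : pointedType)
  [set i | [/\ measurable i.1.1, measurable i.1.2 & 0 < i.2]]
  (fun i => [set T : aut | (mu ((T @` i.1.1) `+` i.1.2) < i.2%:E)%E]).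

End automorphisms.

Section actions.
Context (R : realType) d (X : measurableType d) (mu : probability X R).
Context (G : groupType).

(* Homomorphisms G -> Aut(X, mu), inside the product space Aut(X, mu)^G. *)
Definition is_pmp_action : set {ptws G -> aut mu} :=
  [set a : {ptws G -> aut mu} |
    forall g h : G, {ae mu, forall x, a (g * h)%g x = a g (a h x)}].

(* A(G, X, mu), with the subspace topology *)
Definition pmp_action := set_type is_pmp_action.

HB.instance Definition _ := Topological.on pmp_action.

Definition act (a : pmp_action) (g : G) : aut mu := set_val a g.

(* FR(G, X, mu) *)
Definition free_actions : set pmp_action :=
  [set a | forall g : G, g != 1%g -> mu [set x | act a g x = x] = 0%E].

Definition generated_subgroup (F : set G) : set G :=
  smallest (fun H : set G => group_closed (mem H)) F.

(* The orbit equivalence relation of the restriction of a to H. As act a g is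
   a class modulo null sets, this is an equivalence relation, independent of
   representatives, on a conull set. *)
Definition orbit_rel (a : pmp_action) (H : set G) : relation X :=
  fun x y => exists2 g, H g & act a g x = y.

End actions.

Arguments free_actions [R d X] mu G.

Section cost.
Context (R : realType) d (X : measurableType d) (mu : probability X R).

Definition conull (Y : set X) : Prop := measurable Y /\ mu (~` Y) = 0%E.

Definition ae_subrel (E E' : relation X) : Prop :=
  exists2 Y, conull Y & forall x y, Y x -> Y y -> E x y -> E' x y.

Definition ae_eqrel (E E' : relation X) : Prop :=
  exists2 Y, conull Y & forall x y, Y x -> Y y -> (E x y <-> E' x y).

Definition borel_equivalence (E : relation X) : Prop :=
  equivalence X E /\ measurable [set p : X * X | E p.1 p.2].

(* The values of pbij_fun outside of pbij_dom are irrelevant. *)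
Record partial_mpbij := PartialMpbij {
  pbij_dom : set X;
  pbij_cod : set X;
  pbij_fun :> X -> X;
  pbij_dom_measurable : measurable pbij_dom;
  pbij_cod_measurable : measurable pbij_cod;
  pbij_measurable : measurable_fun pbij_dom pbij_fun;
  pbij_bij : set_bij pbij_dom pbij_cod pbij_fun;
  pbij_preserving : forall B, measurable B -> B `<=` pbij_cod ->
    mu (pbij_dom `&` pbij_fun @^-1` B) = mu B
}.

(* Countable families are indexed by nat; finite ones are padded with maps
   of empty domain, which change neither the cost nor the relation. *)
Definition generated_rel (Phi : nat -> partial_mpbij) : relation X :=
  clos_refl_sym_trans X (fun x y => exists i, pbij_dom (Phi i) x /\ Phi i x = y).

Definition graphing_cost (Phi : nat -> partial_mpbij) : \bar R :=
  (\sum_(0 <= i <oo) mu (pbij_dom (Phi i)))%E.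

Definition Lgraphing (E : relation X) (Phi : nat -> partial_mpbij) : Prop :=
  ae_eqrel (generated_rel Phi) E.

Definition cost (E : relation X) : \bar R :=
  ereal_inf [set graphing_cost Phi | Phi in Lgraphing E].

End cost.

(* A_{F,r}(G, X, mu); the inclusions, like the actions, are modulo null sets. *)
Definition A_Fr (R : realType) d (X : measurableType d) (mu : probability X R)
    (G : groupType) (F : set G) (r : \bar R) : set (pmp_action mu G) :=
  [set a | exists E : relation X,
    [/\ borel_equivalence E,
        ae_subrel mu (orbit_rel a (generated_subgroup F)) E,
        ae_subrel mu E (orbit_rel a [set: G]) &
        (cost mu E < r)%E]].

Arguments A_Fr [R d X] mu [G] F r.

(* Main.v *)
(* A graphing [Phi] of [E] of cost < r can be cut so that each piece is the
   restriction of one group element [e j] to a set [A i j].  Almost every x is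
   joined to [a f x], f in F, by a finite path of pieces, and by freeness the
   group elements along that path multiply to f.  Up to small measure, finitely
   many paths suffice, and whether x follows one of them only depends on
   finitely many memberships of [a h x] in [A i j].  For b near a, most x
   therefore satisfy the same memberships, and the same path joins x to [b f x]
   since this is an identity in the group.  Adding to the pieces [b (e j)] on
   [A i j] the map [b f] on the small exceptional set gives a graphing
   witnessing that b lies in A_{F,r}. *)

Require Import Defs.
From HB Require Import structures.
From Stdlib Require Import Relation_Definitions Relation_Operators Operators_Properties.
From mathcomp Require Import all_boot finmap all_order all_algebra.
From mathcomp Require Import all_classical all_reals all_analysis lra.

Set Implicit Arguments.
Unset Strict Implicit.
Unset Printing Implicit Defensive.

Import Order.TTheory GRing.Theory Num.Theory.
Import numFieldNormedType.Exports.

Local Open Scope classical_set_scope.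
Local Open Scope ring_scope.

(** * Measurability of the diagonal, of equalizers and of inverses *)

Lemma standard_borel_diagonal (R : realType) d (X : measurableType d) :
  standard_borel R X -> measurable [set p : X * X | p.1 = p.2].
Proof.
move=> [P [hP [B cB [Bo Bb]] [f [bf fm]]]].
have mB V : B V -> measurable (f @^-1` V).
  by move=> BV; apply/fm; apply: sub_sigma_algebra; exact: Bo.
rewrite -[X in measurable X]setCK; apply: measurableC.
(* Distinct points of a Hausdorff space are separated by a basic open set, so the complement of the
   diagonal is a countable union of measurable rectangles. *)
suff -> : ~` [set p : X * X | p.1 = p.2] =
    \bigcup_(V in B) ((f @^-1` V) `*` ~` (f @^-1` V)).
  rewrite bigcup_set_type; apply: countable_bigcupT_measurable => [|[V /= VB]].
    move/countable_injP : cB => [c ci]; apply/countable_injP.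
    exists (c \o val) => U V _ _ /= UV; apply: val_inj; apply: ci => //.
      exact: valP.
    exact: valP.
  rewrite in_setE in VB; apply: measurableX; first exact: mB.
  by apply: measurableC; exact: mB.
apply/seteqP; split => [[x y] /= xy|[x y] [V BV] [/= fx fy] xy]; last first.
  by apply: fy; rewrite -xy.
have fxy : f x != f y by apply/eqP => /(bij_inj bf).
have [V [W [VW Vx Wy VW0]]] : exists V W, [/\ open V, V (f x), W (f y) & V `&` W = set0].
  move: hP; rewrite open_hausdorff => /(_ _ _ fxy)[[V W] /= [Vx Wy] [oV oW /eqP VW]].
  by exists V, W; split => //; exact: set_mem.
have := Bb (f x) V; rewrite /= => /(_ _)[].
  by apply: open_nbhs_nbhs; split.
move=> U [BU Ux] UV; exists U => //; split => //= Uy.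
have : (V `&` W) (f y) by split => //; exact: UV.
by rewrite VW0.
Qed.

Lemma measurable_equalizer d (X : measurableType d) (f g : X -> X) :
  measurable [set p : X * X | p.1 = p.2] ->
  measurable_fun setT f -> measurable_fun setT g -> measurable [set x | f x = g x].
Proof.
move=> mD mf mg; have := measurable_fun_pair mf mg.
by move=> /(_ measurableT _ mD); rewrite setTI.
Qed.

Lemma mpauto_inv (R : realType) d (X : measurableType d) (mu : probability X R)
    (f : mpauto mu) :
  exists g : X -> X, [/\ cancel f g, cancel g f & measurable_fun setT g].
Proof.
have [g fK gK] := mpauto_bij f; exists g; split => // _ A mA; rewrite setTI.
suff -> : g @^-1` A = f @` A by exact: mpauto_image.
apply/seteqP; split => [x /= Ax|_ [x Ax <-] /=]; last by rewrite fK.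
by exists (g x).
Qed.

Lemma countable_surj (T : choiceType) (t : T) :
  countable [set: T] -> exists e : nat -> T, forall x, exists n, e n = x.
Proof.
move=> /countable_injP[f fi].
exists (fun n => xget t [set x | f x = n]) => x; exists (f x).
by case: xgetP => [y _ /= /fi ->|/(_ x)/(_ erefl)] //; rewrite in_setE.
Qed.

(** * Conull sets *)

Section conull.
Context (R : realType) d (X : measurableType d) (mu : probability X R).

Lemma conullP (Y : set X) :
  conull mu Y <-> measurable Y /\ mu.-negligible (~` Y).
Proof.
by split=> -[mY Y0]; split => //; apply/negligibleP => //; exact: measurableC.
Qed.

Lemma conullT : conull mu setT.
Proof. by split; [exact: measurableT|rewrite setCT measure0]. Qed.

Lemma conullI (Y Z : set X) : conull mu Y -> conull mu Z -> conull mu (Y `&` Z).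
Proof.
move=> /conullP[mY Y0] /conullP[mZ Z0]; apply/conullP; split.
  exact: measurableI.
by rewrite setCI; exact: negligibleU.
Qed.

Lemma conull_bigcap (Y : nat -> set X) :
  (forall n, conull mu (Y n)) -> conull mu (\bigcap_n Y n).
Proof.
move=> cY; apply/conullP; split.
  by apply: bigcapT_measurable => n; case: (cY n).
by rewrite setC_bigcap; apply: negligible_bigcup => n; case/conullP: (cY n).
Qed.

Lemma conull_preimage (f : mpauto mu) (Y : set X) :
  conull mu Y -> conull mu (f @^-1` Y).
Proof.
move=> [mY Y0]; split.
  by have := mpauto_measurable f measurableT mY; rewrite setTI.
by rewrite preimage_setC mpauto_preserving//; exact: measurableC.
Qed.

Lemma conull_ae (P : set X) : measurable P -> {ae mu, forall x, P x} -> conull mu P.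
Proof. by move=> mP aeP; exact/conullP. Qed.

End conull.

(** * Invariant conull sets on which the action laws hold exactly *)

Section core.
Context (R : realType) d (X : measurableType d) (mu : probability X R).
Context (G : groupType).
Hypothesis mD : measurable [set p : X * X | p.1 = p.2].
Hypothesis G_countable : countable [set: G].

(** Representatives of classes in [aut] obey the action laws only almost everywhere; inside such a
    [Y] orbits can be handled pointwise. *)
Definition acts_pointwise (a : pmp_action mu G) (Y : set X) :=
  [/\ forall x, Y x -> act a 1%g x = x,
      forall g h x, Y x -> act a (g * h)%g x = act a g (act a h x) &
      forall g x, Y x -> Y (act a g x)].

Lemma act_measurable (a : pmp_action mu G) g A :
  measurable A -> measurable (act a g @^-1` A).
Proof.
by move=> mA; have := mpauto_measurable (repr (act a g)) measurableT mA;
  rewrite setTI.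
Qed.

Lemma actM_ae (a : pmp_action mu G) g h :
  {ae mu, forall x, act a (g * h)%g x = act a g (act a h x)}.
Proof. exact: (set_valP a). Qed.

Lemma conull_actM (a : pmp_action mu G) :
  conull mu [set x | forall g h, act a (g * h)%g x = act a g (act a h x)].
Proof.
have [e eS] := countable_surj (1%g : G) G_countable.
have -> : [set x | forall g h, act a (g * h)%g x = act a g (act a h x)] =
    \bigcap_m \bigcap_n
      [set x | act a (e m * e n)%g x = act a (e m) (act a (e n) x)].
  apply/seteqP; split => [x ax m _ n _|x ax g h]; first exact: ax.
  by have [m <-] := eS g; have [n <-] := eS h; exact: ax.
do 2 (apply: conull_bigcap => ?).
apply: conull_ae; last exact: actM_ae.
apply: measurable_equalizer => //; first exact: mpauto_measurable.
apply: (@measurableT_comp _ _ _ _ _ _ (act a _) _ (act a _));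
  exact: mpauto_measurable.
Qed.

(** The points of [Y1] whose whole orbit stays in [Y1] form an invariant set, conull because [G] is
    countable and each [act a g] preserves [mu]. *)
Lemma invariant_core (a : pmp_action mu G) (Y : set X) : conull mu Y ->
  exists2 Z, conull mu Z & Z `<=` Y /\ acts_pointwise a Z.
Proof.
move=> cY; pose Y1 := Y `&` [set x | forall g h, act a (g * h)%g x = act a g (act a h x)].
have cY1 : conull mu Y1 by apply: conullI => //; exact: conull_actM.
have [e eS] := countable_surj (1%g : G) G_countable.
exists (Y1 `&` \bigcap_n (act a (e n) @^-1` Y1)).
  by apply: conullI => //; apply: conull_bigcap => n; exact: conull_preimage.
split => [x [[]]//|]; split.
(* Injectivity of [act a 1] turns the product law for 1 and 1 into the identity law. *)
- move=> x [[_ ax] _]; apply: (bij_inj (mpauto_bij (repr (act a 1%g)))).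
  by have := ax 1%g 1%g; rewrite mul1g.
- by move=> g h x [[_ ax] _]; exact: ax.
- move=> g x [[_ ax] Yx]; have [n eg] := eS g.
  split; first by have := Yx n I; rewrite /= eg.
  move=> k _ /=; rewrite -ax; have [l <-] := eS (e k * g)%g.
  exact: Yx.
Qed.

End core.

(** * The weak topology on actions *)

Lemma act_continuous (R : realType) d (X : measurableType d)
    (mu : probability X R) (G : groupType) (g : G) :
  continuous (fun a : pmp_action mu G => act a g).
Proof.
move=> a; apply: (@continuous_comp _ _ _
  (set_val : pmp_action mu G -> {ptws G -> aut mu}) (@proj G (fun=> aut mu) g)).
  exact: initial_continuous.
exact: proj_continuous.
Qed.

Lemma aut_subbase_open (R : realType) d (X : measurableType d)
    (mu : probability X R) (A B : set X) (r : R) :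
  measurable A -> measurable B -> 0 < r ->
  open [set T : aut mu | (mu ((T @` A) `+` B) < r%:E)%E].
Proof.
move=> mA mB r0; pose i := (A, B, r).
exists [set [set T : aut mu | (mu ((T @` A) `+` B) < r%:E)%E]]; last by rewrite bigcup_set1.
move=> _ ->; exists (fset1 i); last by rewrite set_fset1 bigcap_set1.
by move=> j; rewrite !inE => /eqP ->.
Qed.

(** * Restrictions of automorphisms as pieces of graphings *)

Section restriction.
Context (R : realType) d (X : measurableType d) (mu : probability X R).

Lemma restrict_set_bij (f : mpauto mu) (A : set X) : set_bij A (f @` A) f.
Proof.
split => [x Ax|x y _ _|//]; first by exists x.
exact: (bij_inj (mpauto_bij f)).
Qed.

Lemma restrict_measurable (f : mpauto mu) (A : set X) : measurable_fun A f.
Proof. by apply: (measurable_funS measurableT) => //; exact: mpauto_measurable. Qed.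

Lemma restrict_preserving (f : mpauto mu) (A B : set X) :
  measurable B -> B `<=` f @` A -> mu (A `&` f @^-1` B) = mu B.
Proof.
move=> mB BA; rewrite -(mpauto_preserving f mB); congr (mu _).
apply/seteqP; split => [x []//|x /= Bfx]; split => //.
by have [y Ay /(bij_inj (mpauto_bij f)) <-] := BA _ Bfx.
Qed.

Definition restrict_mpauto (f : mpauto mu) (A : set X) (mA : measurable A) :=
  @PartialMpbij _ _ _ mu A (f @` A) f mA (@mpauto_image _ _ _ mu f A mA) (@restrict_measurable f A)
    (@restrict_set_bij f A) (@restrict_preserving f A).

(** [S] prefixes a chain by one step, along some [f i] or back along its inverse [g i], so the
    generated relation is the union of the iterates of [S] on the diagonal. Each iterate is built
    from preimages, hence measurable. *)
Lemma generated_rel_restrict_measurable (f : nat -> mpauto mu) (A : nat -> set X)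
    (mA : forall i, measurable (A i)) :
  measurable [set p : X * X | p.1 = p.2] ->
  measurable [set p | generated_rel (fun i => restrict_mpauto (f i) (mA i)) p.1 p.2].
Proof.
move=> mD; have /choice[g gP] := fun i => mpauto_inv (f i).
pose S (E : set (X * X)) := \bigcup_i
  ([set p | A i p.1 /\ E (f i p.1, p.2)] `|` [set p | A i (g i p.1) /\ E (g i p.1, p.2)]).
pose Q n := iter n S [set p : X * X | p.1 = p.2].
have mcomp (h : X -> X) : measurable_fun setT h ->
    measurable_fun setT (fun p : X * X => (h p.1, p.2)).
  by move=> mh; apply: measurable_fun_pair => //; exact: measurableT_comp.
have mS E : measurable E -> measurable (S E).
  move=> mE; apply: bigcupT_measurable => i; have [_ _ mg] := gP i.
  apply: measurableU.
    rewrite (_ : [set p | _] = (A i `*` setT) `&` (fun p => (f i p.1, p.2)) @^-1` E).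
      apply: measurableI; first exact: measurableX.
      by rewrite -[X in measurable X]setTI; apply: mcomp => //; exact: mpauto_measurable.
    by apply/seteqP; split => [[x y] []|[x y] [[]]].
  rewrite (_ : [set p | _] = (g i @^-1` A i `*` setT) `&` (fun p => (g i p.1, p.2)) @^-1` E).
    apply: measurableI.
      by apply: measurableX => //; rewrite -[X in measurable X]setTI; exact: mg.
    by rewrite -[X in measurable X]setTI; apply: mcomp.
  by apply/seteqP; split => [[x y] []|[x y] [[]]].
suff -> : [set p | generated_rel (fun i => restrict_mpauto (f i) (mA i)) p.1 p.2]
    = \bigcup_n Q n.
  by apply: bigcupT_measurable => n; elim: n => //= n; exact: mS.
apply/seteqP; split => [[x y] /=|[x y] [n _]].
  move=> /clos_rst_rst1n_iff; elim => [z|z t u zt _ [n _ Qn]]; first by exists 0%N.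
  exists n.+1 => //; case: zt => [[i /= [Ai fi]]|[i /= [Ai fi]]]; exists i => //=.
    by left; split => //; rewrite fi.
  by have [fK _ _] := gP i; right; rewrite -fi fK; split.
elim: n x => [|n IH] x; first by move=> /= ->; exact: rst_refl.
move=> [i _ /=]; case=> -[Ai /IH]; apply: rst_trans; first by apply: rst_step; exists i.
have [_ gK _] := gP i.
by apply: rst_sym; apply: rst_step; exists i; split => //=.
Qed.

End restriction.

(** * Paths in the group read off from finitely many memberships *)

Section linking.
Context (R : realType) d (X : measurableType d) (mu : probability X R).
Context (G : groupType) (e : nat -> G) (A : nat -> nat -> set X).

(* [linked n b f x]: the first n pieces, read at the points [b h x] with h among
   the first n elements, connect 1 to f in G. *)
Definition edge n (b : pmp_action mu G) (x : X) : relation G := fun h h' =>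
  exists t : 'I_n * 'I_n * 'I_n,
    [/\ h = e t.1.1, h' = (e t.2 * h)%g & A t.1.2 t.2 (act b h x)].

Definition linked n (b : pmp_action mu G) (f : G) : set X :=
  [set x | clos_refl_sym_trans G (edge n b x) 1%g f].

Lemma clos_refl_sym_trans_mono T (r s : relation T) :
  (forall x y, r x y -> s x y) ->
  forall x y, clos_refl_sym_trans T r x y -> clos_refl_sym_trans T s x y.
Proof.
move=> rs x y; elim => {x y} [x y /rs|x|x y _ xy|x y z _ xy _ yz].
- exact: rst_step.
- exact: rst_refl.
- exact: rst_sym.
- exact: rst_trans xy yz.
Qed.

Lemma edgeS n m (b : pmp_action mu G) x h h' : (n <= m)%N ->
  edge n b x h h' -> edge m b x h h'.
Proof.
move=> nm [[[l i] j] /= [hl hj Ax]].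
by exists (widen_ord nm l, widen_ord nm i, widen_ord nm j).
Qed.

Lemma linkedS n m (b : pmp_action mu G) f : (n <= m)%N ->
  linked n b f `<=` linked m b f.
Proof. by move=> nm x; apply: clos_refl_sym_trans_mono => h h'; exact: edgeS. Qed.

(** Being linked is monotone in the finitely many memberships it reads, so a point that stops being
    linked has lost one of them. *)
Lemma linked_diff n (a b : pmp_action mu G) f :
  linked n a f `\` linked n b f `<=`
  \bigcup_(t : 'I_n * 'I_n * 'I_n) (act a (e t.1.1) @^-1` A t.1.2 t.2 `\`
    act b (e t.1.1) @^-1` A t.1.2 t.2).
Proof.
move=> x [ax bx]; apply: contrapT => H; apply: bx.
apply: clos_refl_sym_trans_mono ax => h h' [t [hl hj Ax]].
exists t; split => //; apply: contrapT => Bx; apply: H; exists t => //=.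
by rewrite -hl.
Qed.

(** A condition on finitely many membership bits selects a finite union of atoms of the algebra
    generated by the [B t]. *)
Lemma finite_pattern_measurable (I : finType) (B : I -> set X)
    (P : {ffun I -> bool} -> Prop) :
  (forall t, measurable (B t)) -> measurable [set x | P [ffun t => `[< B t x >]]].
Proof.
move=> mB.
have -> : [set x | P [ffun t => `[< B t x >]]] =
    \bigcup_(T in P) \bigcap_(t : I) (if T t then B t else ~` B t).
  apply/seteqP; split => [x Px|x [T PT xT] /=].
    exists [ffun t => `[< B t x >]] => // t _ /=; rewrite ffunE.
    by case: asboolP.
  rewrite (_ : [ffun _ => _] = T)//; apply/ffunP => t; rewrite ffunE.
  have /= := xT t Logic.I.
  by case: (T t) => Bt; apply/asboolP.
apply: fin_bigcup_measurable => // T _.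
apply: fin_bigcap_measurable => // t _.
by case: (T t) => //; exact: measurableC.
Qed.

Lemma linked_measurable n (b : pmp_action mu G) f :
  (forall i j, measurable (A i j)) -> measurable (linked n b f).
Proof.
move=> mA.
pose P (T : {ffun 'I_n * 'I_n * 'I_n -> bool}) :=
  clos_refl_sym_trans G (fun h h' => exists t : 'I_n * 'I_n * 'I_n,
    [/\ h = e t.1.1, h' = (e t.2 * h)%g & T t]) 1%g f.
have := @finite_pattern_measurable _
  (fun t : 'I_n * 'I_n * 'I_n => act b (e t.1.1) @^-1` A t.1.2 t.2) P
  (fun t => act_measurable b _ (mA _ _)).
congr measurable; apply/seteqP; split => x;
  apply: clos_refl_sym_trans_mono => h h' [t [hl hj Tt]]; exists t; split => //.
  by move: Tt; rewrite ffunE /= -hl => /asboolP.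
by rewrite ffunE; apply/asboolP; rewrite /= -hl.
Qed.

(** The orbit map sending h to [act b h x] carries a path in [G] from 1 to [f] to an [E]-chain from
    x to [act b f x]. The path lives in the group, so it serves every action [b]. *)
Lemma linked_rel n (b : pmp_action mu G) (Y : set X) (E : relation X) f x :
  acts_pointwise b Y -> equivalence X E ->
  (forall i j y, (i < n)%N -> (j < n)%N -> A i j y -> E y (act b (e j) y)) ->
  Y x -> linked n b f x -> E x (act b f x).
Proof.
move=> [b1 bM bY] [Er Et Es] EA Yx /= xf; rewrite -{1}(b1 _ Yx).
elim: xf => [h h' [t [_ -> At]]|h|h h' _|h k l _ hk _].
- by rewrite bM//; apply: EA At; exact: ltn_ord.
- exact: Er.
- exact: Es.
- exact: Et.
Qed.

(** A chain of [Phi] from x lifts step by step to a path in [G] from 1. Its endpoint h is only known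
    through its effect on x; freeness will identify it. *)
Lemma rel_linked (a : pmp_action mu G) (Z : set X)
    (Phi : nat -> partial_mpbij mu) x y :
  (forall g, exists n, e n = g) -> acts_pointwise a Z ->
  (forall i z, Z z -> pbij_dom (Phi i) z ->
    exists2 j, A i j z & Phi i z = act a (e j) z) ->
  (forall i z, pbij_dom (Phi i) z -> Z (Phi i z) -> Z z) ->
  Z x -> generated_rel Phi x y ->
  exists2 h, y = act a h x & exists n, linked n a h x.
Proof.
move=> eS [a1 aM aZ] Phi1 Phi2 Zx /clos_rst_rstn1_iff.
elim => [|{}y z yz _ [h yE [n nh]]].
  by exists 1%g; [rewrite a1|exists 0%N; exact: rst_refl].
have link k i j : A i j (act a k x) -> exists m, linked m a h x /\ edge m a x k (e j * k)%g.
  move=> Aij; have [l kl] := eS k.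
  (* The bound is large enough for the path found so far and for the three indices of the new
     edge. *)
  exists (n + (maxn l (maxn i j)).+1)%N; split.
    by apply: linkedS nh; rewrite leq_addr.
  have lt p : (p <= maxn l (maxn i j))%N -> (p < n + (maxn l (maxn i j)).+1)%N.
    by move=> ?; rewrite addnS ltnS (leq_trans _ (leq_addl _ _)).
  have ll : (l < n + (maxn l (maxn i j)).+1)%N by rewrite lt// leq_maxl.
  have li : (i < n + (maxn l (maxn i j)).+1)%N by rewrite lt// !leq_max leqnn orbT.
  have lj : (j < n + (maxn l (maxn i j)).+1)%N by rewrite lt// !leq_max leqnn !orbT.
  by exists (Ordinal ll, Ordinal li, Ordinal lj); split => //=; rewrite kl.
have Zy : Z y by rewrite yE; exact: aZ.
case: yz => -[i [Di Pi]].
  have [j Aj Pj] := Phi1 _ _ Zy Di; exists (e j * h)%g.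
    by rewrite -Pi Pj yE aM.
  rewrite yE in Aj; have [m [mh me]] := link _ _ _ Aj.
  by exists m; apply: rst_trans mh _; exact: rst_step.
(* A map traversed backwards: the path is extended by the inverse of [e j]. *)
have Zz : Z z by apply: (Phi2 i) => //; rewrite Pi.
have [j Aj Pj] := Phi1 _ _ Zz Di.
have zE : z = act a ((e j)^-1 * h)%g x.
  by rewrite aM// -yE -Pi Pj -aM// mulVg a1.
exists ((e j)^-1 * h)%g => //.
rewrite zE in Aj; have [m [mh me]] := link _ _ _ Aj.
exists m; apply: rst_trans mh _; apply: rst_sym; apply: rst_step.
by move: me; rewrite mulgA mulgV mul1g.
Qed.

End linking.

(** * Graphings given by finite lists of restricted group elements *)

Section list_graphing.
Context (R : realType) d (X : measurableType d) (mu : probability X R).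
Context (G : groupType) (b : pmp_action mu G) (s : seq (G * set X)).
Hypothesis mD : measurable [set p : X * X | p.1 = p.2].
Hypothesis G_countable : countable [set: G].
Hypothesis ms : forall k, measurable (nth (1%g, set0) s k).2.

(** Beyond the end of [s] the default entry has empty domain, so it adds neither cost nor
    relations. *)
Definition list_graphing (k : nat) : partial_mpbij mu :=
  restrict_mpauto (repr (act b (nth (1%g, set0) s k).1)) (ms k).

Lemma list_graphing_borel : borel_equivalence (generated_rel list_graphing).
Proof.
split; last exact: generated_rel_restrict_measurable.
by split => [x|x y z|x y]; [exact: rst_refl|exact: rst_trans|exact: rst_sym].
Qed.

Lemma list_graphing_step p x : p \in s -> p.2 x ->
  generated_rel list_graphing x (act b p.1 x).
Proof.
move=> ps px; apply: rst_step; exists (index p s).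
by rewrite /list_graphing /= nth_index.
Qed.

Lemma list_graphing_orbit :
  ae_subrel mu (generated_rel list_graphing) (orbit_rel b [set: G]).
Proof.
have [Y cY [_ [b1 bM bY]]] := invariant_core mD G_countable b (conullT mu).
exists Y => // x y Yx _ /clos_rst_rstn1_iff xy.
suff [h ->] : exists h, y = act b h x by exists h.
elim: xy => [|{}y z yz _ [h yE]]; first by exists 1%g; rewrite b1.
case: yz => -[k [_ /=]]; set g := (nth _ _ _).1 => gE.
  by exists (g * h)%g; rewrite bM// -yE -gE.
exists (g^-1 * h)%g; apply: (bij_inj (mpauto_bij (repr (act b g)))).
by rewrite [LHS]gE -[RHS]/(act b g _) -bM// mulgA mulgV mul1g.
Qed.

Lemma list_graphing_cost :
  (cost mu (generated_rel list_graphing) <= \sum_(p <- s) mu p.2)%E.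
Proof.
apply: (@le_trans _ _ (graphing_cost list_graphing)).
  apply: ereal_inf_lbound; exists list_graphing => //.
  by exists setT; first exact: conullT.
rewrite /graphing_cost (nneseries_split _ (size s)) ?add0n; last first.
  by move=> k _; exact: measure_ge0.
rewrite [X in (_ + X)%E]eseries0 ?adde0; last first.
  by move=> k sk _; rewrite /= nth_default// measure0.
by rewrite (big_nth (1%g, set0)).
Qed.

End list_graphing.

(** * Preimages under nearby actions *)

Section continuity.
Context (R : realType) d (X : measurableType d) (mu : probability X R).
Context (G : groupType).
Hypothesis mD : measurable [set p : X * X | p.1 = p.2].
Hypothesis G_countable : countable [set: G].

(** The weak topology controls images, so the preimage of [A] under g is treated as its image under
    the inverse of g; the two agree up to a null set. *)
Lemma near_preimage (a : pmp_action mu G) (g : G) (A : set X) (r : R) :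
  measurable A -> 0 < r ->
  \forall b \near a, (mu (act a g @^-1` A `\` act b g @^-1` A) < r%:E)%E.
Proof.
move=> mA r0; pose B := act a g^-1%g @` A.
have mB : measurable B by exact: (@mpauto_image _ _ _ mu (repr (act a g^-1%g))).
have aU : nbhs (act a g^-1%g) [set T : aut mu | (mu ((T @` A) `+` B) < r%:E)%E].
  apply: open_nbhs_nbhs; split; first exact: aut_subbase_open.
  by rewrite /= setYK measure0 lte_fin.
have aV : nbhs a [set b | (mu ((act b g^-1%g @` A) `+` B) < r%:E)%E].
  exact: (@act_continuous R d X mu G g^-1%g a _ aU).
apply: filterS aV => b /=; apply: le_lt_trans.
have [Ya cYa [_ [a1 aM aY]]] := invariant_core mD G_countable a (conullT mu).
have [Yb cYb [_ [b1 bM bY]]] := invariant_core mD G_countable b (conullT mu).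
have mbA : measurable (act b g^-1%g @` A).
  exact: (@mpauto_image _ _ _ mu (repr (act b g^-1%g))).
have mDiff : measurable (act a g @^-1` A `\` act b g @^-1` A).
  by apply: measurableD; exact: act_measurable.
have mY : measurable (act b g^-1%g @` A `+` B).
  by apply: measurableU; apply: measurableD.
have [mN N0] := conullI cYa cYb.
apply: (@le_trans _ _ (mu ((act b g^-1%g @` A `+` B) `|` ~` (Ya `&` Yb)))).
  apply: le_measure; rewrite ?inE//; first by apply: measurableU => //; exact: measurableC.
  move=> x [/= aA bA]; have [Yx|] := pselect ((Ya `&` Yb) x); last by right.
  case: Yx => Yax Ybx; left; right; split.
    by exists (act a g x) => //; rewrite -aM// mulVg a1.
  move=> [y Ay yx]; apply: bA.
  suff <- : y = act b g x by [].
  apply: (bij_inj (mpauto_bij (repr (act b g^-1%g)))).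
  by rewrite [LHS]yx -[RHS]/(act b g^-1%g _) -bM// mulVg b1.
apply: (le_trans (measureU2 _ _ _)) => //; first exact: measurableC.
by rewrite [X in (_ + X)%E]N0 adde0.
Qed.

End continuity.

(** * Cutting a graphing along group elements *)

Section decomposition.
Context (R : realType) d (X : measurableType d) (mu : probability X R).
Context (G : groupType) (e : nat -> G).
Hypothesis mD : measurable [set p : X * X | p.1 = p.2].
Hypothesis G_countable : countable [set: G].
Hypothesis eS : forall g, exists n, e n = g.

Lemma partial_mpbij_eq_measurable (phi : partial_mpbij mu) (f : mpauto mu) :
  measurable (pbij_dom phi `&` [set x | phi x = f x]).
Proof.
have mdom := pbij_dom_measurable phi.
(* Equalizers are available for total maps, so [phi] is replaced by its extension with a default
   value off the domain. *)
have -> : pbij_dom phi `&` [set x | phi x = f x] =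
    pbij_dom phi `&` [set x | (phi \_ (pbij_dom phi)) x = f x].
  by apply/seteqP; split => x [Dx /= xf]; split => //=; move: xf;
    rewrite patchE mem_set.
apply: measurableI => //; apply: measurable_equalizer => //.
  by apply/(measurable_restrictT _ mdom); exact: pbij_measurable.
exact: mpauto_measurable.
Qed.

Lemma pbij_preimage_measurable (phi : partial_mpbij mu) (B : set X) :
  measurable B -> measurable (pbij_dom phi `&` phi @^-1` B).
Proof.
move=> mB.
exact: (@pbij_measurable _ _ _ _ phi (pbij_dom_measurable phi) B mB).
Qed.

Lemma seqDU_least (T : Type) (B : nat -> set T) j x : B j x ->
  exists k, seqDU B k x.
Proof.
move=> Bx; have : (\bigcup_k B k) x by exists j.
by rewrite seqDU_bigcup_eq => -[k _ kx]; exists k.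
Qed.

(* The last clause, backward invariance of Z under [Phi], is needed because a
   path may traverse a map of [Phi] in reverse. *)
Lemma graphing_decomposition (a : pmp_action mu G)
    (Phi : nat -> partial_mpbij mu) (W : set X) :
  conull mu W ->
  (forall x y, W x -> W y -> generated_rel Phi x y -> orbit_rel a [set: G] x y) ->
  exists A : nat -> nat -> set X, [/\ forall i j, measurable (A i j),
    forall n, (\sum_(0 <= i < n) \sum_(0 <= j < n) mu (A i j) <= graphing_cost Phi)%E &
    exists2 Z, conull mu Z & [/\ Z `<=` W, acts_pointwise a Z,
      forall i z, Z z -> pbij_dom (Phi i) z ->
        exists2 j, A i j z & Phi i z = act a (e j) z &
      forall i z, pbij_dom (Phi i) z -> Z (Phi i z) -> Z z]].
Proof.
move=> cW WPhi.
pose B i j := pbij_dom (Phi i) `&` [set x | Phi i x = act a (e j) x].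
have mB i j : measurable (B i j) by exact: partial_mpbij_eq_measurable.
(* Each point of the domain goes to the first j that fits. The pieces are then disjoint in j, so
   cutting does not raise the cost. *)
pose A i j := seqDU (B i) j.
have mA i j : measurable (A i j) by exact: seqDU_measurable.
have AB i j x : A i j x -> B i j x by exact: subset_seqDU.
exists A; split => //.
  move=> n; apply: le_trans (@nneseries_lim_ge _ _ _ 0%N n _); last by [].
  apply: lee_sum => i _; rewrite big_mkord.
  rewrite -measure_bigsetU//; last exact: trivIset_seqDU.
  apply: le_measure; rewrite ?inE.
  - exact: bigsetU_measurable.
  - exact: pbij_dom_measurable.
  - by rewrite -bigcup_mkord => x [j _ /AB []].
have [Z0 cZ0 [Z0W [a1 aM aZ0]]] := invariant_core mD G_countable a cW.
have mcod i := pbij_cod_measurable (Phi i).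
(* Since [Phi i] preserves measure, the points it sends into a null set form a null set. *)
have N1P i M : measurable M -> mu M = 0%E ->
    conull mu (~` (pbij_dom (Phi i) `&` Phi i @^-1` (pbij_cod (Phi i) `&` M))).
  move=> mM M0; have mcM : measurable (pbij_cod (Phi i) `&` M) by exact: measurableI.
  split; first by apply: measurableC; exact: pbij_preimage_measurable.
  rewrite setCK pbij_preserving//.
  by apply: (subset_measure0 _ _ _ M0).
have mNZ0 : measurable (~` Z0) by apply: measurableC; case: cZ0.
(* Points of [Z0] whose images under [Phi] stay in [Z0]: there both ends of a step lie in [W], so
   the step follows the orbit. *)
have cV1 : conull mu (Z0 `&` \bigcap_i ~` (pbij_dom (Phi i) `&`
    Phi i @^-1` (pbij_cod (Phi i) `&` ~` Z0))).
  apply: conullI => //; apply: conull_bigcap => i; apply: N1P => //.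
  by case: cZ0.
have [Z1 cZ1 [Z1V [_ _ aZ1]]] := invariant_core mD G_countable a cV1.
have Z1Z0 : Z1 `<=` Z0 by move=> x /Z1V [].
have domZ1 i z : Z1 z -> pbij_dom (Phi i) z ->
    exists2 j, A i j z & Phi i z = act a (e j) z.
  move=> Zz Dz; have [Z0z /(_ i Logic.I) /= nz] := Z1V _ Zz.
  have [cod _ _] := pbij_bij (Phi i).
  have Z0p : Z0 (Phi i z).
    by apply: contrapT => nZ; apply: nz; split => //; split => //; exact: cod.
  have [g _ gE] : orbit_rel a [set: G] z (Phi i z).
    apply: WPhi; [exact: Z0W|exact: Z0W|].
    by apply: rst_step; exists i.
  have [j jg] := eS g.
  have Bj : B i j z by split => //=; rewrite jg gE.
  have [k kz] := seqDU_least Bj.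
  by exists k => //; have [] := AB _ _ _ kz.
(* [M i] is the image of [Z1] under [Phi i]; writing it through the
   automorphisms [act a (e j)] makes its measurability evident. *)
pose M i := \bigcup_j (act a (e j) @` (A i j `&` Z1)).
have mM i : measurable (M i).
  apply: bigcupT_measurable => j; apply: (@mpauto_image _ _ _ mu (repr (act a (e j)))).
  by apply: measurableI => //; case: cZ1.
(* The part of the codomain outside [M i] has its preimage outside [Z1], hence is null. *)
have cM i : conull mu (~` (pbij_cod (Phi i) `\` M i)).
  have mcM : measurable (pbij_cod (Phi i) `\` M i) by exact: measurableD.
  split; first exact: measurableC.
  rewrite setCK -(@pbij_preserving _ _ _ mu (Phi i))//.
  apply: (subset_measure0 _ _ _ (proj2 cZ1)).
  - exact: pbij_preimage_measurable.
  - by apply: measurableC; case: cZ1.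
  - move=> x [Dx /= [_ nM]] Zx; apply: nM; have [j Aj xj] := domZ1 _ _ Zx Dx.
    by exists j => //; exists x.
have cV2 : conull mu (Z1 `&` \bigcap_i ~` (pbij_cod (Phi i) `\` M i)).
  by apply: conullI => //; exact: conull_bigcap.
have [Z2 cZ2 [Z2V aZ2]] := invariant_core mD G_countable a cV2.
exists Z2 => //; split => //.
- by move=> x /Z2V [/Z1Z0 /Z0W].
- by move=> i z /Z2V[Z1z _]; exact: domZ1.
- move=> i z Dz Zp; have [_ /(_ i Logic.I) /= nM] := Z2V _ Zp.
  have [cod inj _] := pbij_bij (Phi i).
  (* The image of z is also the image of some y in [Z1]; injectivity gives y = z. Hence z is a
     translate of [Phi i z], and invariance puts it in [Z2]. *)
  have [j _ [y [/AB [Dy /= yj] Z1y] yz]] : M i (Phi i z).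
    by apply: contrapT => nMz; apply: nM; split => //; exact: cod.
  have zy : y = z by apply: inj; rewrite ?inE//; rewrite yj.
  move: Z1y yj yz; rewrite zy => Z1z zj _; case: aZ2 => _ _ aZ2.
  have -> : z = act a (e j)^-1%g (Phi i z).
    by rewrite zj -aM ?mulVg ?a1//; exact: Z1Z0.
  exact: aZ2.
Qed.

Lemma conull_free (a : pmp_action mu G) : free_actions mu G a ->
  conull mu [set x | forall g, g != 1%g -> act a g x != x].
Proof.
move=> fa; have mfix g : measurable [set x | act a g x = x].
  by apply: (@measurable_equalizer _ _ (act a g) id) => //; exact: mpauto_measurable.
have -> : [set x | forall g, g != 1%g -> act a g x != x] =
    \bigcap_n (if e n == 1%g then setT else ~` [set x | act a (e n) x = x]).
  apply/seteqP; split => [x fx n _|x fx g g1].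
    by case: ifPn => // /fx /eqP.
  have [n ng] := eS g; move: (fx n Logic.I); rewrite ng (negbTE g1) /=.
  by move=> H; apply/eqP.
apply: conull_bigcap => n; case: ifPn => [_|/fa f0].
  exact: conullT.
by split; [exact: measurableC|rewrite setCK].
Qed.

(** A lifted path ends at some h acting on x as [f] does; freeness at x forces h = f. *)
Lemma linked_exhausts (A : nat -> nat -> set X) (a : pmp_action mu G)
    (Z : set X) (Phi : nat -> partial_mpbij mu) f x :
  acts_pointwise a Z ->
  (forall i z, Z z -> pbij_dom (Phi i) z ->
    exists2 j, A i j z & Phi i z = act a (e j) z) ->
  (forall i z, pbij_dom (Phi i) z -> Z (Phi i z) -> Z z) ->
  Z x -> (forall g, g != 1%g -> act a g x != x) ->
  generated_rel Phi x (act a f x) -> exists n, linked e A n a f x.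
Proof.
move=> aZ Phi1 Phi2 Zx free /(rel_linked eS aZ Phi1 Phi2 Zx)[h fh [n nh]].
suff -> : f = h by exists n.
have [a1 aM _] := aZ; apply: contrapT => /eqP neq.
have : (h^-1 * f)%g != 1%g.
  by apply: contra neq => /eqP hf; rewrite -[f](mulVKg h) hf mulg1.
by move=> /free; rewrite aM// fh -aM// mulVg a1// eqxx.
Qed.

End decomposition.

(** * Elementary estimates *)

Lemma natmul_small (R : realType) (m : nat) (r : R) :
  0 < r -> exists2 s, 0 < s & s *+ m <= r.
Proof.
(* The successor keeps the divisor nonzero when m = 0. *)
move=> r0; exists (r / m.+1%:R); first by rewrite divr_gt0.
by rewrite -[_ *+ m]mulr_natr mulrAC ler_pdivrMr// ler_wpM2l ?(ltW r0)// ler_nat.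
Qed.

Lemma lte_add_pos (R : realType) (c r : \bar R) : (0 <= c)%E -> (c < r)%E ->
  exists2 s : R, 0 < s & (c + s%:E < r)%E.
Proof.
move=> c0 cr; have cfin : c \is a fin_num.
  by rewrite ge0_fin_numE// (lt_le_trans cr)// leey.
move: c cfin cr {c0} => [c| |]//= _; case: r => [r| |]// cr.
  rewrite lte_fin in cr; exists ((r - c) / 2); first by rewrite divr_gt0// subr_gt0.
  by rewrite -EFinD lte_fin; lra.
by exists 1 => //; rewrite -EFinD ltry.
Qed.

Lemma measure_seq_le (R : realType) d (X : measurableType d)
    (mu : {measure set X -> \bar R}) (I : eqType) (s : seq I) (D : I -> set X) :
  (forall i, measurable (D i)) ->
  (mu (\big[setU/set0]_(i <- s) D i) <= \sum_(i <- s) mu (D i))%E.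
Proof.
move=> mDi; elim: s => [|i s IH]; first by rewrite !big_nil measure0.
rewrite !big_cons; apply: (le_trans (measureU2 _ _ _)) => //.
  by apply: bigsetU_measurable.
exact: leeD.
Qed.

Lemma forall_eventually (I : eqType) (s : seq I) (P : I -> nat -> Prop) :
  (forall i, i \in s -> \forall n \near \oo, P i n) ->
  exists n, forall i, i \in s -> P i n.
Proof.
move=> sP; suff : \forall n \near \oo, forall i, i \in s -> P i n.
  by move=> [n _ nP]; exists n; apply: nP => /=.
elim: s sP => [_|i s IH sP]; first exact: nearW.
have Pi := sP i (mem_head _ _).
have Ps : \forall n \near \oo, forall j, j \in s -> P j n.
  by apply: IH => j js; apply: sP; rewrite in_cons js orbT.
by apply: filterS2 Pi Ps => n Pi Ps j; rewrite in_cons => /predU1P[->|/Ps].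
Qed.

(** * Stability of the cost bound under perturbation *)

Section main.
Context (R : realType) d (X : measurableType d) (mu : probability X R).
Context (G : groupType) (e : nat -> G).
Hypothesis mD : measurable [set p : X * X | p.1 = p.2].
Hypothesis G_countable : countable [set: G].
Hypothesis eS : forall g, exists n, e n = g.

(** Continuity from above: the unlinked sets decrease in n and their intersection misses [Z]. *)
Lemma unlinked_cvg (A : nat -> nat -> set X) (a : pmp_action mu G)
    (Z : set X) f (r : R) :
  (forall i j, measurable (A i j)) -> conull mu Z ->
  (forall x, Z x -> exists n, linked e A n a f x) -> 0 < r ->
  \forall n \near \oo, (mu (~` linked e A n a f) < r%:E)%E.
Proof.
move=> mA cZ Zl r0.
have mC n : measurable (~` linked e A n a f).
  by apply: measurableC; exact: linked_measurable.
have mcap : measurable (\bigcap_n ~` linked e A n a f) by exact: bigcapT_measurable.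
have cv : mu (~` linked e A n a f) @[n --> \oo] --> mu (\bigcap_n ~` linked e A n a f).
  apply: (@nonincreasing_cvg_mu _ _ _ mu (fun n => ~` linked e A n a f)) => //.
  - by rewrite -ge0_fin_numE// fin_num_measure.
  - by move=> n m nm; apply/subsetPset => x /= H ln; apply: H; exact: linkedS ln.
have cap0 : mu (\bigcap_n ~` linked e A n a f) = 0%E.
  apply: (subset_measure0 _ _ _ (proj2 cZ)) => //.
    by apply: measurableC; case: cZ.
  by move=> x xl /Zl[n]; exact: xl.
rewrite cap0 in cv; apply: (cv [set y | (y < r%:E)%E]).
by apply: open_nbhs_nbhs; split; [exact: open_ereal_lt_ereal|rewrite /= lte_fin].
Qed.

(** The generated relation works for every [b]: [s1] lists the transported pieces, and [s2] repairs
    the points not linked to f by applying [b f] directly. Closeness of [b] to the free action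
    matters only for the size of the repairs. *)
Lemma perturbed_cost (F : set G) (Fs : seq G) (A : nat -> nat -> set X) n
    (b : pmp_action mu G) :
  (forall i j, measurable (A i j)) -> F = [set` Fs] ->
  exists E : relation X,
    [/\ borel_equivalence E,
        ae_subrel mu (orbit_rel b (generated_subgroup F)) E,
        ae_subrel mu E (orbit_rel b [set: G]) &
        (cost mu E <= \sum_(0 <= i < n) \sum_(0 <= j < n) mu (A i j) +
          \sum_(f <- Fs) mu (~` linked e A n b f))%E].
Proof.
move=> mA FE.
pose s1 := [seq (e p.2, A p.1 p.2) |
  p <- [seq (i, j) | i <- index_iota 0 n, j <- index_iota 0 n]].
pose s2 := [seq (f, ~` linked e A n b f) | f <- Fs].
have ms k : measurable (nth (1%g, set0) (s1 ++ s2) k).2.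
  have [ks|ks] := ltnP k (size (s1 ++ s2)); last by rewrite nth_default /=.
  have := mem_nth (1%g, set0) ks; rewrite mem_cat => /orP[] /mapP[p _ ->] //=.
  by apply: measurableC; exact: linked_measurable.
pose E := generated_rel (list_graphing b ms).
have [Eeq mE] : borel_equivalence E by exact: list_graphing_borel.
exists E; split => //.
- have [Y cY [_ bY]] := invariant_core mD G_countable b (conullT mu).
  exists Y => // x _ Yx _ [g Fg <-].
  have [b1 bM bYY] := bY; have [Er Et Es] := Eeq.
  (* The elements moving points of [Y] inside their [E]-classes form a subgroup, so it suffices to
     treat [F]. *)
  pose H := [set g | forall x, Y x -> E x (act b g x)].
  suff : generated_subgroup F `<=` H by apply.
  apply: smallest_sub.
    split; first by rewrite inE => y Yy; rewrite b1.
    move=> h k; rewrite !inE => Hh Hk y Yy.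
    have Yk : Y (act b k^-1%g y) by exact: bYY.
    rewrite bM//; apply: Et (Hh _ Yk).
    have := Hk _ Yk; rewrite -bM// mulgV b1//; exact: Es.
  move=> f Ff y Yy; rewrite FE /= in Ff.
  have [l|nl] := pselect (linked e A n b f y).
    apply: (linked_rel bY Eeq _ Yy l) => i j z ni nj Az.
    apply: (@list_graphing_step _ _ _ _ _ b _ ms (e j, A i j)) => //.
    rewrite mem_cat; apply/orP; left; apply/mapP; exists (i, j) => //.
    by apply/allpairsP; exists (i, j); rewrite /= !mem_index_iota.
  apply: (@list_graphing_step _ _ _ _ _ b _ ms (f, ~` linked e A n b f)) => //.
  by rewrite mem_cat; apply/orP; right; apply/mapP; exists f.
- exact: list_graphing_orbit.
- apply: (le_trans (list_graphing_cost b ms)).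
  by rewrite big_cat /= !big_map big_allpairs.
Qed.

(** By [linked_diff] a link is lost only through one of the n^3 memberships, and near [a] each loss
    has measure below [s], an n^3-th share of [r]. *)
Lemma near_unlinked (A : nat -> nat -> set X) (a : pmp_action mu G) n f (r : R) :
  (forall i j, measurable (A i j)) -> 0 < r ->
  \forall b \near a,
    (mu (~` linked e A n b f) <= mu (~` linked e A n a f) + r%:E)%E.
Proof.
move=> mA r0; have [s s0 sr] := natmul_small #|{: 'I_n * 'I_n * 'I_n}| r0.
pose D (b : pmp_action mu G) (t : 'I_n * 'I_n * 'I_n) :=
  act a (e t.1.1) @^-1` A t.1.2 t.2 `\` act b (e t.1.1) @^-1` A t.1.2 t.2.
pose U t := [set b | (mu (D b t) < s%:E)%E].
have nD : nbhs a [set b | forall t, U t b].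
  apply: (@filter_forall _ _ U (nbhs a)) => t.
  exact: near_preimage.
apply: filterS nD => b bD.
have mDb t : measurable (D b t) by apply: measurableD; exact: act_measurable.
have ml c : measurable (~` linked e A n c f).
  by apply: measurableC; exact: linked_measurable.
apply: (@le_trans _ _ (mu (~` linked e A n a f `|`
    \big[setU/set0]_(t <- enum {: 'I_n * 'I_n * 'I_n}) D b t))).
  apply: le_measure; rewrite ?inE//.
    by apply: measurableU => //; exact: bigsetU_measurable.
  move=> x nx; have [l|nl] := pselect (linked e A n a f x); last by left.
  right; have [t _ Dt] := linked_diff (conj l nx).
  by rewrite -bigcup_seq; exists t => //=; rewrite mem_enum.
apply: (le_trans (measureU2 _ _ _)) => //; first exact: bigsetU_measurable.
rewrite leeD2l//; apply: (le_trans (measure_seq_le _ _ mDb)).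
apply: (@le_trans _ _ (\sum_(t <- enum {: 'I_n * 'I_n * 'I_n}) s%:E)%E).
  by apply: lee_sum => t _; apply/ltW/bD.
by rewrite sumEFin lee_fin big_enum /= sumr_const; exact: sr.
Qed.

Lemma free_A_Fr_nbhs (F : set G) (r : \bar R) (a : pmp_action mu G) :
  finite_set F -> A_Fr mu F r a -> free_actions mu G a -> nbhs a (A_Fr mu F r).
Proof.
move=> /finite_seqP[Fs FE] [E [_ [Y1 cY1 FY] [Y2 cY2 EY] cE]] fa.
have [_ [Phi [Y3 cY3 PhiY] <-] Phir] := ereal_inf_lt cE.
have cW := conullI (conullI (conullI cY1 cY2) cY3) (conull_free mD eS fa).
have [|A [mA sA [Z cZ [ZW aZ Phi1 Phi2]]]] :=
  graphing_decomposition mD G_countable eS cW (a := a) (Phi := Phi).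
  move=> x y [[[_ x2] x3] _] [[[_ y2] y3] _] xy.
  by apply: EY => //; exact/PhiY.
have Zl f x : F f -> Z x -> exists n, linked e A n a f x.
  move=> Ff Zx; have [[[x1 x2] x3] fx] := ZW _ Zx.
  apply: (linked_exhausts eS aZ Phi1 Phi2 Zx fx).
  have [_ _ aZ'] := aZ; have [[[y1 y2] y3] _] := ZW _ (aZ' f _ Zx).
  apply/PhiY => //; apply: FY => //; exists f => //.
  exact: sub_gen_smallest.
have c0 : (0 <= graphing_cost Phi)%E by apply: nneseries_ge0 => *; exact: measure_ge0.
(* The slack [del] between the cost of [Phi] and [r] is shared among [Fs]. Half of each share [eps]
   covers the points unlinked under [a], the other half the change from [a] to [b]. *)
have [del del0 delr] := lte_add_pos c0 Phir.
have [eps eps0 epsdel] := natmul_small (size Fs) del0.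
have eps20 : 0 < eps / 2 by rewrite divr_gt0.
have [n nl] : exists n, forall f, f \in Fs -> (mu (~` linked e A n a f) < (eps / 2)%:E)%E.
  apply: forall_eventually => f fF; apply: (unlinked_cvg mA cZ) => // x.
  by apply: Zl; rewrite FE.
(* Indexing by the finite type [seq_sub Fs] makes this a finite intersection of neighbourhoods. *)
pose U (f : seq_sub Fs) : set (pmp_action mu G) := [set b | mu (~` linked e A n b (val f)) <=
  mu (~` linked e A n a (val f)) + (eps / 2)%:E]%E.
have nU : nbhs a [set b | forall f, U f b].
  by apply: (@filter_forall _ _ U (nbhs a)) => f; exact: near_unlinked.
apply: filterS nU => b bl.
have [E' [bE' FE' Eb cE']] := @perturbed_cost F Fs A n b mA FE.
exists E'; split => //; apply: le_lt_trans cE' _; apply: le_lt_trans delr.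
apply: leeD => //; apply: (@le_trans _ _ (\sum_(f <- Fs) eps%:E)%E).
  rewrite big_seq [leRHS]big_seq; apply: lee_sum => f fF.
  apply: (le_trans (bl (SeqSub fF))); rewrite [eps in leRHS]splitr EFinD.
  by rewrite leeD2r//; apply/ltW/nl.
by rewrite sumEFin lee_fin big_const_seq count_predT iter_addr_0.
Qed.

End main.

Theorem theorem6p4 (R : realType) (d : measure_display) (X : measurableType d)
    (mu : probability X R) (G : groupType)
    (X_standard : standard_borel R X) (mu_nonatomic : nonatomic mu)
    (G_countable : countable [set: G]) (G_infinite : infinite_set [set: G])
    (F : set G) (F_finite : finite_set F) (r : \bar R) (r_neq : r != -oo%E) :
  (A_Fr mu F r `&` free_actions mu G `<=` interior (A_Fr mu F r)) /\
  open (A_Fr mu F r `&` free_actions mu G : set (subspace (free_actions mu G))).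
Proof.
have mD := standard_borel_diagonal X_standard.
have [e eS] := countable_surj (1%g : G) G_countable.
have sub : A_Fr mu F r `&` free_actions mu G `<=` interior (A_Fr mu F r).
  by move=> a [aF fa]; exact: (free_A_Fr_nbhs mD G_countable eS).
(* By [sub], [A_Fr] and its interior have the same trace on the free actions. *)
split=> //; apply/open_subspaceP; exists (interior (A_Fr mu F r)).
  exact: open_interior.
rewrite -setIA setIid; apply/seteqP; split => a.
  by move=> [/interior_subset aF fa]; split.
by move=> [aF fa]; split => //; apply: sub.
Qed.
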